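(* Let $X$ be a $k$-regular distance regular graph with diameter $d$, let $U$ be the transition matrix of the Grover walk on $X$, and let $Y_i$ be the $i$-th distance digraph of $\mathrm{LD}(X)$. If the adjacency matrix $A(X)$ is invertible, then there are real scalars $t_1,t_2,\dots,t_d$ such that \[U^2=\exp(t_1S(Y_1))\exp(t_2S(Y_2))\cdots\exp(t_dS(Y_d)),\] and the matrices $S(Y_1),\dots,S(Y_d)$ pairwise commute.
   Context: $X$ is a connected distance regular graph (for vertices $u,v$ at distance $\ell$, the number of vertices at distance $i$ from $u$ and $j$ from $v$ depends only on $i,j,\ell$). Each edge $\{a,b\}$ of $X$ is replaced by arcs $(a,b)$ and $(b,a)$. The line digraph $\mathrm{LD}(X)$ has the arcs as vertices, with an arc from $(a,b)$ to $(c,d)$ iff $b=c$; $A(\mathrm{LD}(X))$ is its $01$-adjacency matrix. $R$ is the permutation matrix on arcs mapping $(a,b)$ to $(b,a)$. The transition matrix of the Grover walk is $U=\frac{2}{k}A(\mathrm{LD}(X))-R$. For a digraph $Y$, its $i$-th distance digraph $Y_i$ has the same vertex set, with $a$ adjacent to $b$ iff the directed distance from $a$ to $b$ in $Y$ is $i$. For a digraph $Z$ with $01$-adjacency matrix $A(Z)$, its skew-adjacency matrix is $S(Z)=A(Z)-A(Z)^T$. *)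

(* Defs.v *)
From HB Require Import structures.
From mathcomp Require Import all_boot all_order all_algebra.
From mathcomp Require Import all_classical all_reals all_analysis.
Set Implicit Arguments. Unset Strict Implicit. Unset Printing Implicit Defensive.
Import Order.TTheory GRing.Theory Num.Theory.
Local Open Scope ring_scope.

Fixpoint reach (V : finType) (e : rel V) (n : nat) (u v : V) : bool :=
  match n with
  | 0 => u == v
  | n'.+1 => reach e n' u v || [exists w, reach e n' u w && e w v]
  end.

Definition is_dist (V : finType) (e : rel V) (u v : V) (i : nat) : bool :=
  reach e i u v && ((i == 0%N) || ~~ reach e i.-1 u v).

Definition simple_graph (V : finType) (e : rel V) : Prop :=
  (forall u v, e u v = e v u) /\ (forall u, ~~ e u u).

Definition connected_graph (V : finType) (e : rel V) : Prop :=
  forall u v, exists i, is_dist e u v i.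

Definition regular_graph (V : finType) (e : rel V) (k : nat) : Prop :=
  forall v, #|[set w | e v w]| = k.

Definition distance_regular (V : finType) (e : rel V) : Prop :=
  forall (u v u' v' : V) (l i j : nat),
    is_dist e u v l -> is_dist e u' v' l ->
    #|[set w | is_dist e u w i && is_dist e w v j]| =
    #|[set w | is_dist e u' w i && is_dist e w v' j]|.

Definition has_diameter (V : finType) (e : rel V) (d : nat) : Prop :=
  (exists u v, is_dist e u v d) /\
  (forall u v i, is_dist e u v i -> (i <= d)%N).

Definition arc (V : finType) (e : rel V) := {p : V * V | e p.1 p.2}.

Definition ld_rel (V : finType) (e : rel V) : rel (arc e) :=
  fun x y => (val x).2 == (val y).1.

Definition narc (V : finType) (e : rel V) : nat := #|{: arc e}|.

Definition arc_mx (R : nzRingType) (V : finType) (e : rel V)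
  (f : arc e -> arc e -> R) : 'M[R]_(narc e) :=
  \matrix_(i, j) f (enum_val i) (enum_val j).

Definition arc_adj (R : nzRingType) (V : finType) (e : rel V)
  (r : rel (arc e)) : 'M[R]_(narc e) :=
  @arc_mx R V e (fun x y => (r x y)%:R).

Definition A_LD (R : nzRingType) (V : finType) (e : rel V) : 'M[R]_(narc e) :=
  @arc_adj R V e (@ld_rel V e).

Definition rev_mx (R : nzRingType) (V : finType) (e : rel V) : 'M[R]_(narc e) :=
  @arc_adj R V e (fun x y => (val y == ((val x).2, (val x).1))).

Definition grover (R : fieldType) (V : finType) (e : rel V) (k : nat)
  : 'M[R]_(narc e) :=
  (2%:R / k%:R) *: @A_LD R V e - @rev_mx R V e.

Definition dist_digraph (V : finType) (e : rel V) (i : nat) : rel (arc e) :=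
  fun x y => is_dist (@ld_rel V e) x y i.

Definition skew_adj (R : nzRingType) (V : finType) (e : rel V)
  (r : rel (arc e)) : 'M[R]_(narc e) :=
  @arc_adj R V e r - (@arc_adj R V e r)^T.

Definition adj_mx (R : nzRingType) (V : finType) (e : rel V) : 'M[R]_#|V| :=
  \matrix_(i, j) (e (enum_val i) (enum_val j))%:R.

Definition mexp (R : realType) (n : nat) (M : 'M[R]_n) : 'M[R]_n :=
  limn (fun N : nat => \sum_(k < N) (k`!%:R)^-1 *: M ^+ k).

(* Main.v *)
(** In terms of the head and tail incidence matrices [H] and [T] of the arcs, and
    of the distance matrices [A_i] of the graph, [S(Y_(i+1))] equals
    [H A_i T^T - T A_i H^T]: in the line digraph, the distance from [(a,b)] to
    [(c,d)] is [1 + dist(b,c)], except on the diagonal, which cancels in [S].  Also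
    [U^2 = 1 + (4/k^2) H A T^T - (2/k) (H H^T + T T^T)].
    Let [E_x] be the projector on the [x]-eigenspace of [A].  The matrices
    [K_x = H E_x T^T - T E_x H^T] annihilate each other and satisfy
    [K_x^3 = -(k^2 - x^2) K_x], so [K_x = sigma_x J_x] where [J_x^3 = -J_x] and
    [sigma_x^2 = k^2 - x^2], and [exp(a J_x) = 1 + sin a J_x + (1 - cos a) J_x^2] is
    a rotation by [a].  Both [S(Y_(i+1))] and [U^2] split along the [J_x]: the
    former is the sum of the [v_i(x) sigma_x J_x], where [A_i = v_i(A)], and the
    latter is the product of the rotations by [2 acos(x/k)].  So it suffices to have
    [sum_i t_(i+1) v_i(x) sigma_x = 2 acos(x/k)] whenever [sigma_x <> 0].  As [A] has
    at most [d + 1] eigenvalues and [sigma_k = 0], these are at most [d] conditions,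
    met by a polynomial of degree less than [d]; such a polynomial is a combination
    of [v_0, ..., v_(d-1)] because [v_i] has degree [i]. *)

Require Import Defs.
From HB Require Import structures.
From mathcomp Require Import all_boot all_order all_algebra.
From mathcomp Require Import all_classical all_reals all_analysis.
From mathcomp Require Import spectral complex ring.
Import Order.TTheory GRing.Theory Num.Theory.
Import numFieldNormedType.Exports.
Local Open Scope ring_scope.
Set Implicit Arguments.
Unset Strict Implicit.

(** * Spectra of symmetric matrices and polynomials in a matrix *)

Lemma mxminpoly_invmx_conj (F : fieldType) (n : nat) (P B D : 'M[F]_n.+1) :
  P \in unitmx -> B = invmx P *m D *m P -> mxminpoly B = mxminpoly D.
Proof.
move=> Punit ->; rewrite -(mxminpoly_uconj _ Punit); congr mxminpoly.
by rewrite conjumx // !mulmxA mulmxV // mul1mx mulmxK.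
Qed.

(** Over the complex numbers the matrix is Hermitian, hence diagonalizable with a real diagonal,
    whose minimal polynomial has simple roots. The result descends to [R] because mapping
    polynomials along [f] is injective. *)
Lemma symmetric_mxminpoly (R : rcfType) (n : nat) (A : 'M[R]_n.+1) :
  A^T = A ->
  exists2 s : seq R, uniq s & mxminpoly A = \prod_(x <- s) ('X - x%:P).
Proof.
move=> Asym; pose f := real_complex R; pose B := map_mx f A.
have Breal : B \is a mxOver Num.real.
  by apply/mxOverP => i j; rewrite mxE; apply/complex_realP; exists (A i j).
have Bherm : B \is hermsymmx.
  apply: realsym_hermsym => //; apply/is_hermitianmxP.
  by rewrite expr0 scale1r map_mx_id //; apply/matrixP => i j; rewrite !mxE -{1}Asym mxE.
have /orthomx_spectralP BE := hermitian_normalmx Bherm.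
have /mxOverP Dreal := hermitian_spectral_diag_real Bherm.
have Bmin := mxminpoly_invmx_conj (spectral_unit B) BE.
rewrite mxminpoly_map mxminpoly_diag in Bmin.
set u := undup _ in Bmin.
have uE : u = [seq f (complex.Re x) | x <- u].
  rewrite -[LHS]map_id; apply/eq_in_map => x; rewrite mem_undup.
  by case/mapP=> j _ -> ; case/complex_realP: (Dreal 0 j) => y ->.
exists [seq complex.Re x | x <- u].
  have : uniq u by exact: undup_uniq.
  by rewrite {1}uE (map_comp f) => /map_uniq.
apply: (map_poly_inj f); rewrite [LHS]Bmin {1}uE big_map rmorph_prod big_map.
by apply: eq_bigr => x _; rewrite rmorphB /= map_polyX map_polyC.
Qed.

Lemma poly_interpolation (F : fieldType) (s : seq F) (g : F -> F) :
  uniq s -> {p : {poly F} | (size p <= size s)%N & {in s, forall x, p.[x] = g x}}.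
Proof.
elim: s => [|a s IHs] /=; first by exists 0 => //; rewrite size_poly0.
case/andP=> a_s /IHs[p sp pE]; pose q := \prod_(x <- s) ('X - x%:P).
have qa : q.[a] != 0 by rewrite -[_ == 0]/(root q a) root_prod_XsubC.
exists (p + ((g a - p.[a]) / q.[a]) *: q) => [|x].
  rewrite (leq_trans (size_polyD _ _)) // geq_max (leq_trans sp) //=.
  by rewrite (leq_trans (size_scale_leq _ _)) // size_prod_XsubC.
rewrite inE hornerD hornerZ => /predU1P[->|xs]; first by rewrite divfK // addrC subrK.
have /eqP-> : root q x by rewrite root_prod_XsubC.
by rewrite mulr0 addr0 pE.
Qed.

Lemma graded_polys_span (F : fieldType) (v : nat -> {poly F}) (d : nat) :
  (forall i, (i < d)%N -> size (v i) = i.+1) ->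
  forall p : {poly F}, (size p <= d)%N ->
  exists t : nat -> F, p = \sum_(i < d) t i *: v i.
Proof.
elim: d => [_ p|d IHd sv p sp].
  by rewrite leqn0 size_poly_eq0 => /eqP->; exists (fun=> 0); rewrite big_ord0.
have svd : size (v d) = d.+1 by rewrite sv.
have vd0 : (v d)`_d != 0.
  have := lead_coef_eq0 (v d); rewrite lead_coefE svd /= => ->.
  by rewrite -size_poly_eq0 svd.
pose c := p`_d / (v d)`_d.
have [||t tE] := IHd _ (p - c *: v d); first by move=> i /ltnW; exact: sv.
  apply/leq_sizeP => j; rewrite leq_eqVlt coefB coefZ => /predU1P[<-|dj].
    by rewrite divfK // subrr.
  by rewrite !nth_default ?mulr0 ?subr0 // ?svd // (leq_trans sp).
exists (fun i => if i == d then c else t i); rewrite big_ord_recr /= eqxx.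
rewrite -(subrK (c *: v d) p) tE; congr (_ + _).
by apply: eq_bigr => i _; rewrite ltn_eqF.
Qed.

(** As [c i i.+1] is invertible, the recurrence can be solved for [B i.+1]; all terms other than
    [A * B i] have lower degree, so each step raises the degree by exactly one. *)
Lemma three_term_polys (F : fieldType) (n d : nat) (A : 'M[F]_n.+1)
    (B : nat -> 'M[F]_n.+1) (c : nat -> nat -> F) :
  B 0%N = 1 ->
  (forall i, (i < d)%N -> A * B i = \sum_(l < i.+2) c i l *: B l) ->
  (forall i, (i < d)%N -> c i i.+1 != 0) ->
  exists v : nat -> {poly F}, forall i, (i <= d)%N ->
    size (v i) = i.+1 /\ horner_mx A (v i) = B i.
Proof.
move=> B0; elim: d => [_ _|d IHd AB c0].
  exists (fun=> 1) => i; rewrite leqn0 => /eqP->.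
  by rewrite size_poly1 rmorph1 B0.
have [||v vP] := IHd; [by move=> i /ltnW/AB | by move=> i /ltnW/c0 |].
have cd : c d d.+1 != 0 by rewrite c0.
pose r := \sum_(l < d.+1) c d l *: v l.
exists (fun i => if i == d.+1 then (c d d.+1)^-1 *: ('X * v d - r) else v i).
move=> i; rewrite leq_eqVlt => /predU1P[->|id]; last first.
  by rewrite ltn_eqF //; exact: vP.
have [svd hvd] := vP d (leqnn d).
rewrite eqxx; split.
  have sX : size ('X * v d) = d.+2.
    by rewrite mulrC size_mulX ?svd // -size_poly_eq0 svd.
  rewrite size_scale ?invr_neq0 // size_polyDl sX // size_polyN ltnS.
  rewrite (leq_trans (size_sum _ _ _)) //.
  apply/bigmax_leqP => l _; rewrite (leq_trans (size_scale_leq _ _)) //.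
  by rewrite (proj1 (vP l _)) // -ltnS.
rewrite (horner_mxZ A) rmorphB rmorphM /= horner_mx_X hvd AB // big_ord_recr /=.
rewrite -[RHS](scalerK cd); congr (_ *: _); rewrite raddf_sum /= addrAC.
rewrite -[RHS]add0r; congr (_ + _); apply/eqP; rewrite subr_eq0; apply/eqP.
apply: eq_bigr => l _; rewrite (horner_mxZ A); congr (_ *: _).
by rewrite (proj2 (vP l _)) // -ltnS.
Qed.

Lemma horner_mx_eq_on_spectrum (F : fieldType) (n : nat) (A : 'M[F]_n.+1)
    (s : seq F) (p q : {poly F}) :
  uniq s -> mxminpoly A = \prod_(x <- s) ('X - x%:P) ->
  {in s, forall x, p.[x] = q.[x]} -> horner_mx A p = horner_mx A q.
Proof.
move=> us mA pq; apply/eqP; rewrite -subr_eq0 -rmorphB -dvd_mxminpoly mA.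
apply: uniq_roots_dvdp; last by rewrite uniq_rootsE.
by apply/allP => x xs; rewrite rootE hornerD hornerN pq // subrr.
Qed.

(** [L x] is the Lagrange polynomial of [x] on [s]. Since the minimal polynomial has simple roots,
    each identity only has to be checked on values at the points of [s]. *)
Lemma spectral_projectors (F : fieldType) (n : nat) (A : 'M[F]_n.+1) (s : seq F) :
  uniq s -> mxminpoly A = \prod_(x <- s) ('X - x%:P) ->
  exists L : F -> {poly F},
    [/\ forall p, horner_mx A p = \sum_(x <- s) p.[x] *: horner_mx A (L x),
        {in s, forall x p, horner_mx A p * horner_mx A (L x) = p.[x] *: horner_mx A (L x)}
      & {in s &, forall x y, x != y -> horner_mx A (L x) * horner_mx A (L y) = 0}].
Proof.
move=> us mA.
pose L x := s2val (poly_interpolation (fun y => (y == x)%:R) us).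
have LE x y : y \in s -> (L x).[y] = (y == x)%:R.
  by rewrite /L; case: poly_interpolation => p /= _ pE; exact: pE.
exists L; split => [p|x xs p|x y xs ys xy].
- under eq_bigr => x _ do rewrite -(horner_mxZ A); rewrite -raddf_sum /=.
  apply: (horner_mx_eq_on_spectrum us mA) => x xs; rewrite horner_sum.
  rewrite (bigD1_seq x) //= hornerZ LE // eqxx mulr1 big1 ?addr0 // => y yx.
  by rewrite hornerZ LE // eq_sym (negPf yx) mulr0.
- rewrite -(horner_mxZ A) -rmorphM /=; apply: (horner_mx_eq_on_spectrum us mA) => y ys.
  by rewrite hornerM hornerZ LE //; case: eqP => [->|]; rewrite ?mulr0.
- rewrite -rmorphM -[RHS](rmorph0 (horner_mx A)).
  apply: (horner_mx_eq_on_spectrum us mA) => z zs; rewrite hornerM horner0 !LE //.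
  by case: eqP => [->|]; rewrite ?(negPf xy) ?mulr0 ?mul0r.
Qed.

(** * Exponentials of commuting rotation generators *)

(** Rodrigues' closed form for the exponential of [\sum_(x <- s) a x *: J x], valid when the [J x]
    are orthogonal units. *)
Definition rotation (R : realType) (I : Type) (m : nat) (s : seq I)
    (J : I -> 'M[R]_m) (a : I -> R) : 'M[R]_m :=
  1%:M + \sum_(x <- s) (sin (a x) *: J x + (1 - cos (a x)) *: (J x *m J x)).

(* Each [J x] behaves like the imaginary unit on the range of [J x], on which
   [- (J x *m J x)] is the identity. *)
Definition orthogonal_units (R : realType) (I : eqType) (m : nat) (s : seq I)
    (J : I -> 'M[R]_m) : Prop :=
  {in s &, forall x y, x != y -> J x *m J y = 0} /\
  {in s, forall x, J x *m (J x *m J x) = - J x}.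

Lemma rotation0 (R : realType) (I : eqType) (m : nat) (s : seq I)
    (J : I -> 'M[R]_m) : rotation s J (fun=> 0) = 1%:M.
Proof.
rewrite /rotation big1 ?addr0 // => x _.
by rewrite sin0 cos0 subrr !scale0r addr0.
Qed.

Lemma mul_sum_orthogonal (R : nzRingType) (I : eqType) (m : nat) (s : seq I)
    (F G : I -> 'M[R]_m) :
  uniq s -> {in s &, forall x y, x != y -> F x *m G y = 0} ->
  (\sum_(x <- s) F x) *m (\sum_(x <- s) G x) = \sum_(x <- s) F x *m G x.
Proof.
move=> us FG; rewrite mulmx_suml; apply: eq_big_seq => x xs.
rewrite mulmx_sumr (bigD1_seq x) //= big_seq_cond big1 ?addr0 // => y.
by case/andP=> ys yx; rewrite FG // eq_sym.
Qed.

(** Distinct blocks annihilate each other, so the product is computed block by block, where it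
    amounts to the addition formulas for sine and cosine. *)
Lemma rotationD (R : realType) (I : eqType) (m : nat) (s : seq I)
    (J : I -> 'M[R]_m) (a b : I -> R) :
  uniq s -> orthogonal_units s J ->
  rotation s J a *m rotation s J b = rotation s J (fun x => a x + b x).
Proof.
move=> us [JJ J3]; rewrite /rotation mulmxDl mulmxDr mul1mx mulmxDr mulmx1.
rewrite !mul1mx -!addrA; congr (_ + _); rewrite mul_sum_orthogonal //.
  rewrite -!big_split /=; apply: eq_big_seq => x xs.
  have J3x := J3 x xs.
  have J3x' : (J x *m J x) *m J x = - J x by rewrite -mulmxA.
  rewrite sinD cosD !mulmxDl !mulmxDr -!scalemxAl -!scalemxAr J3x J3x'.
  rewrite -mulmxA J3x mulmxN; move: (J x) (J x *m J x) => K L.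
  by apply/matrixP => i j; rewrite !mxE; ring.
move=> x y xs ys xy.
rewrite !mulmxDl !mulmxDr -!scalemxAl -!scalemxAr !mulmxA.
by rewrite -!(mulmxA _ (J x) (J y)) JJ // !mulmx0 !mul0mx !scaler0 !addr0.
Qed.

Lemma exprmxS (R : pzRingType) (m k : nat) (M : 'M[R]_m) : M ^+ k.+1 = M *m M ^+ k.
Proof. by rewrite exprS. Qed.

(** Up to sign, odd powers of [J x] are [J x] and positive even powers are [J x *m J x], so the
    exponential series splits termwise into sine and cosine series. At index 0 only the identity
    remains, as the constant term of [1 - cos] is 0. *)
Lemma exp_coeff_rotation (R : realType) (I : eqType) (m : nat) (s : seq I)
    (J : I -> 'M[R]_m) (a : I -> R) (k : nat) :
  uniq s -> orthogonal_units s J ->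
  (k`!%:R)^-1 *: (\sum_(x <- s) a x *: J x) ^+ k =
  (k == 0%N)%:R *: 1%:M + \sum_(x <- s)
    (sin_coeff (a x) k *: J x + ((k == 0%N)%:R - cos_coeff (a x) k) *: (J x *m J x)).
Proof.
move=> us [JJ J3]; case: k => [|k] /=.
  rewrite expr0 fact0 invr1 scale1r big1 ?addr0 ?scale1r // => x _.
  have -> : sin_coeff (a x) 0 = 0 by rewrite /sin_coeff /= !mul0r.
  have -> : cos_coeff (a x) 0 = 1.
    by rewrite /cos_coeff /= fact0 expr0 !mul1r mulr1n invr1.
  by rewrite subrr !scale0r addr0.
rewrite scale0r add0r.
have -> : (\sum_(x <- s) a x *: J x) ^+ k.+1 = \sum_(x <- s) (a x ^+ k.+1) *: J x ^+ k.+1.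
  elim: k => [|k IHk]; first by under [RHS]eq_bigr do rewrite !expr1.
  rewrite exprmxS IHk mul_sum_orthogonal //.
    apply: eq_bigr => x _.
    by rewrite -scalemxAl -scalemxAr scalerA -exprS -exprmxS.
  move=> x y xs ys xy.
  by rewrite -scalemxAl -scalemxAr exprmxS mulmxA JJ // mul0mx !scaler0.
rewrite scaler_sumr; apply: eq_big_seq => x xs; rewrite scalerA sub0r.
(* The exponent is [k.+1], so it is even exactly when [k] is odd. *)
have -> : J x ^+ k.+1 = (-1) ^+ k./2 *: (if odd k then J x *m J x else J x).
  elim: k => [|k IHk]; first by rewrite scale1r expr1.
  rewrite exprmxS IHk -scalemxAr -[k.+1./2]/(uphalf k) uphalf_half /=.
  by case: (odd k) => //=; rewrite J3 // exprS scalerN mulN1r scaleNr.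
rewrite scalerA /sin_coeff /cos_coeff /= -exprnP -?[k.+1./2]/(uphalf k) ?uphalf_half.
rewrite exprD.
case: (odd k) => /=; rewrite ?mul0r ?oppr0 ?scale0r ?addr0 ?add0r; congr (_ *: _);
  move: (a x ^+ _) (_^-1) ((-1) ^+ _) => u v w; rewrite ?expr1; ring.
Qed.

Lemma mexp_rotation (R : realType) (I : eqType) (m : nat) (s : seq I)
    (J : I -> 'M[R]_m) (a : I -> R) :
  uniq s -> orthogonal_units s J ->
  mexp (\sum_(x <- s) a x *: J x) = rotation s J a.
Proof.
move=> us Js; rewrite /mexp.
(* Partial sums of the constant 1: the empty sum [u 0] is 0, and [u N] is 1 from [N = 1] on. *)
pose u (N : nat) : R := series (fun k => (k == 0%N)%:R) N.
have u1 : (u @ \oo --> (1 : R))%classic.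
  apply: cvg_near_cst; exists 1%N => // N /= N1; rewrite /u /series /=.
  by rewrite big_ltn // big_nat big1 ?addr0 // => i /andP[]; case: i.
have cvgM (w : nat -> R) (l : R) (M : 'M[R]_m) :
    (w @ \oo --> l)%classic -> ((fun N => w N *: M) @ \oo --> l *: M)%classic.
  move=> wl; exact: cvgZr_tmp wl.
apply: cvg_lim; first exact: norm_hausdorff.
rewrite (_ : (fun N => _) = (fun N => u N *: 1%:M + \sum_(x <- s)
   (series (sin_coeff (a x)) N *: J x +
    (u N - series (cos_coeff (a x)) N) *: (J x *m J x)))); last first.
  apply/funext => N.
  under eq_bigr => k _ do rewrite exp_coeff_rotation //.
  rewrite big_split exchange_big /= -scaler_suml; congr (_ *: _ + _).
    by rewrite /u /series /= big_mkord.
  apply: eq_bigr => x _; rewrite big_split /= -!scaler_suml sumrB.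
  by rewrite /u /series /= !big_mkord.
apply: cvgD; first by have := cvgM u 1 1%:M u1; rewrite scale1r.
apply: cvg_big => [|x _]; first exact: add_continuous.
apply: cvgD; apply: cvgM.
  by rewrite sin.unlock; exact: is_cvg_series_sin_coeff.
by apply: cvgB => //; rewrite cos.unlock; exact: is_cvg_series_cos_coeff.
Qed.

(** * Skew matrices built from the incidence matrices *)

(** The trace of [M *m M^T] is a sum of squares, zero only for [M = 0]. By skewness
    [\tr (K *m K) <= 0], and the sum of squares for [K *m K] is [mu] times this trace; so
    [K *m K = 0], and then [K = 0]. *)
Lemma skew_cube_eq0 (R : realFieldType) (m : nat) (K : 'M[R]_m) (mu : R) :
  K^T = - K -> K *m (K *m K) = mu *: K -> 0 <= mu -> K = 0.
Proof.
have tr_ge0 (M : 'M[R]_m) : 0 <= \tr (M *m M^T).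
  rewrite /mxtrace sumr_ge0 // => i _; rewrite mxE sumr_ge0 // => j _.
  by rewrite mxE -expr2 sqr_ge0.
have tr_eq0 (M : 'M[R]_m) : \tr (M *m M^T) = 0 -> M = 0.
  have S0 i : 0 <= (M *m M^T) i i.
    by rewrite mxE sumr_ge0 // => j _; rewrite mxE -expr2 sqr_ge0.
  move=> M0; apply/matrixP => i j; rewrite [RHS]mxE.
  have /eqP Mi : (M *m M^T) i i == 0.
    by apply/eqP; apply: (psumr_eq0P _ M0).
  move: Mi; rewrite mxE => Mi; apply/eqP; rewrite -sqrf_eq0 expr2.
  have : M i j * M^T j i = 0.
    by apply: (psumr_eq0P _ Mi) => // l _; rewrite mxE -expr2 sqr_ge0.
  by rewrite mxE => ->.
move=> Kskew K3 mu0.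
have trK2 : \tr (K *m K) <= 0.
  by have := tr_ge0 K; rewrite Kskew mulmxN raddfN oppr_ge0.
have K2sym : (K *m K)^T = K *m K by rewrite trmx_mul Kskew mulNmx mulmxN opprK.
apply: (tr_eq0 K); rewrite Kskew mulmxN.
suff -> : K *m K = 0 by rewrite oppr0 mxtrace0.
apply: tr_eq0; apply/eqP; rewrite eq_le tr_ge0 andbT K2sym -mulmxA K3.
by rewrite -scalemxAr mxtraceZ mulr_ge0_le0.
Qed.

Definition skew_lift (R : pzRingType) (m n : nat) (H T : 'M[R]_(m, n))
    (B : 'M[R]_n) : 'M[R]_m := H *m B *m T^T - T *m B *m H^T.

Lemma sandwich_mul (R : pzRingType) (m n : nat) (X Y Z W : 'M[R]_(m, n))
    (B C G : 'M[R]_n) :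
  Y^T *m Z = G -> (X *m B *m Y^T) *m (Z *m C *m W^T) = X *m (B *m G *m C) *m W^T.
Proof. by move=> <-; rewrite !mulmxA. Qed.

(** A Gram matrix of [H] and [T] sits in the middle of each of the four products. Commutation and
    orthogonality of lifts thus reduce to properties of [B *m A *m C] and [B *m C]. *)
Lemma skew_lift_mul (R : comPzRingType) (m n : nat) (H T : 'M[R]_(m, n))
    (A B C : 'M[R]_n) (k : R) :
  H^T *m H = k%:M -> T^T *m T = k%:M -> T^T *m H = A -> H^T *m T = A ->
  skew_lift H T B *m skew_lift H T C =
  H *m (B *m A *m C) *m T^T + T *m (B *m A *m C) *m H^T
  - k *: (H *m (B *m C) *m H^T + T *m (B *m C) *m T^T).
Proof.
move=> HH TT TH HT; rewrite /skew_lift mulmxBl !mulmxBr.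
rewrite (sandwich_mul _ _ _ _ TH) (sandwich_mul _ _ _ _ TT).
rewrite (sandwich_mul _ _ _ _ HH) (sandwich_mul _ _ _ _ HT).
rewrite !mul_mx_scalar -!scalemxAl -!scalemxAr -!scalemxAl.
move: (H *m _ *m T^T) (T *m _ *m H^T) (H *m _ *m H^T) (T *m _ *m T^T) => P Q U V.
by apply/matrixP => i j; rewrite !mxE; ring.
Qed.

Lemma skew_lift_sum (R : comPzRingType) (I : Type) (m n : nat) (H T : 'M[R]_(m, n))
    (s : seq I) (c : I -> R) (E : I -> 'M[R]_n) :
  skew_lift H T (\sum_(x <- s) c x *: E x) = \sum_(x <- s) c x *: skew_lift H T (E x).
Proof.
rewrite /skew_lift !mulmx_sumr !mulmx_suml -sumrB; apply: eq_bigr => x _.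
by rewrite -!scalemxAr -!scalemxAl scalerBr.
Qed.

(* For [`|x| > k], which no eigenvalue of the graph satisfies, the junk value
   [Num.sqrt y = 0] for [y < 0] gives speed [0]; then [skew_lift_eq0] below still
   holds, so that no bound on the eigenvalues is ever needed. *)
Definition block_speed (R : realType) (k x : R) : R :=
  k * Num.sqrt (1 - (x / k) ^+ 2).

Section BlockRotations.

Variables (R : realType) (m n : nat) (H T : 'M[R]_(m, n)) (A : 'M[R]_n) (k : R).
Hypotheses (k0 : 0 < k) (HH : H^T *m H = k%:M) (TT : T^T *m T = k%:M)
  (TH : T^T *m H = A) (HT : H^T *m T = A).

Let sine (x : R) : R := Num.sqrt (1 - (x / k) ^+ 2).
Let sigma : R -> R := block_speed k.

Variables (x : R) (E : 'M[R]_n).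
Hypotheses (AE : A *m E = x *: E) (EE : E *m E = E) (Esym : E^T = E).

Let K := skew_lift H T E.

Lemma skew_lift_sqr :
  K *m K = x *: (H *m E *m T^T + T *m E *m H^T)
           - k *: (H *m E *m H^T + T *m E *m T^T).
Proof.
rewrite (skew_lift_mul _ _ HH TT TH HT) -(mulmxA E A E) AE -scalemxAr EE.
by rewrite -!scalemxAr -!scalemxAl [x *: (_ + _)]scalerDr.
Qed.

Lemma skew_lift_cube : K *m (K *m K) = (x ^+ 2 - k ^+ 2) *: K.
Proof.
rewrite skew_lift_sqr /K /skew_lift mulmxBl !mulmxBr -!scalemxAr !mulmxDr.
rewrite !(sandwich_mul _ _ _ _ TH) !(sandwich_mul _ _ _ _ TT).
rewrite !(sandwich_mul _ _ _ _ HH) !(sandwich_mul _ _ _ _ HT).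
rewrite -!(mulmxA E _ E) AE !mul_scalar_mx -!scalemxAr !EE.
rewrite -?scalemxAr -?scalemxAl.
move: (H *m _ *m T^T) (T *m _ *m H^T) (H *m _ *m H^T) (T *m _ *m T^T) => P Q U V.
by apply/matrixP => i j; rewrite !mxE; ring.
Qed.

Lemma sqr_sigma : sigma x != 0 -> sigma x ^+ 2 = k ^+ 2 - x ^+ 2.
Proof.
rewrite /sigma /block_speed mulf_eq0 negb_or => /andP[_ s0].
have pos : 0 <= 1 - (x / k) ^+ 2.
  by rewrite leNgt; apply: contra s0 => /ltW ?; rewrite /sine ler0_sqrtr.
by rewrite exprMn sqr_sqrtr //; field; rewrite gt_eqF.
Qed.

(** A vanishing speed means [k ^+ 2 <= x ^+ 2], so the cube of the skew matrix [K] is a nonnegative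
    multiple of [K]. *)
Lemma skew_lift_eq0 : sigma x = 0 -> K = 0.
Proof.
move/eqP; rewrite /sigma /block_speed mulf_eq0 gt_eqF //= sqrtr_eq0 => le0.
apply: (skew_cube_eq0 _ skew_lift_cube).
  by rewrite /K /skew_lift linearB /= !trmx_mul !trmxK Esym !mulmxA opprB.
move: le0; rewrite subr_le0 exprMn exprVn ler_pdivlMr ?exprn_gt0 // mul1r.
by rewrite subr_ge0.
Qed.

(** As [0^-1 = 0], this is 0 when the speed vanishes, and [unit_skew_cube] holds in that case
    too. *)
Let J := (sigma x)^-1 *: K.

Lemma skew_liftE : K = sigma x *: J.
Proof.
rewrite /J scalerA; have [s0|s0] := eqVneq (sigma x) 0.
  by rewrite skew_lift_eq0 // scaler0.
by rewrite divff // scale1r.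
Qed.

Lemma unit_skew_cube : J *m (J *m J) = - J.
Proof.
rewrite /J; have [->|s0] := eqVneq (sigma x) 0.
  by rewrite invr0 !scale0r mul0mx oppr0.
rewrite -!scalemxAl -!scalemxAr !scalerA skew_lift_cube scalerA.
rewrite (_ : _ * (x ^+ 2 - _) = - (sigma x)^-1) ?scaleNr //.
by rewrite -[x ^+ 2 - _]opprB -sqr_sigma //; field.
Qed.

(** The left-hand side is the [x]-block of [U ^+ 2 - 1], a combination of [K] and [K *m K]. For
    nonzero speed, [sigma x] is [k] times the sine of [acos (x / k)], and the double-angle formulas
    match the coefficients; for speed 0 both sides vanish. *)
Lemma grover_block_rotation :
  (4%:R / k ^+ 2 * x) *: (H *m E *m T^T)
   - (2%:R / k) *: (H *m E *m H^T + T *m E *m T^T)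
  = sin (acos (x / k) *+ 2) *: J + (1 - cos (acos (x / k) *+ 2)) *: (J *m J).
Proof.
transitivity ((2%:R * x / k ^+ 2) *: K + (2%:R / k ^+ 2) *: (K *m K)).
  rewrite skew_lift_sqr /K /skew_lift.
  move: (H *m _ *m T^T) (T *m _ *m H^T) (H *m _ *m H^T) (T *m _ *m T^T) => P Q U V.
  by apply/matrixP => i j; rewrite !mxE; field; rewrite gt_eqF.
rewrite /J -!scalemxAl -!scalemxAr !scalerA.
have [s0|s0] := eqVneq (sigma x) 0.
  by rewrite skew_lift_eq0 // mul0mx !scaler0.
have sine0 : sine x != 0 by move: s0; rewrite mulf_eq0 negb_or => /andP[].
(* Outside this interval the square root would be the default value 0; inside it [cos] inverts
   [acos]. *)
have xk : -1 <= x / k <= 1.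
  rewrite -ler_norml -(@expr_le1 _ 2) // real_normK ?num_real // leNgt.
  by apply: contra sine0 => x1; rewrite /sine ler0_sqrtr // subr_le0 ltW.
have cosE : cos (acos (x / k)) = x / k by rewrite acosK // in_itv.
have sinE : sin (acos (x / k)) = sine x by rewrite sin_acos.
have sine2 : sine x ^+ 2 = 1 - (x / k) ^+ 2.
  by rewrite -sinE -[in RHS]cosE sin2cos2.
congr (_ *: _ + _ *: _).
  rewrite sin_mulr2n cosE sinE /sigma /block_speed -/(sine x).
  by field; rewrite sine0 gt_eqF.
rewrite cos_mulr2n cosE -(subKr 1 ((x / k) ^+ 2)) -sine2 /sigma /block_speed -/(sine x).
by field; rewrite sine0 gt_eqF.
Qed.

End BlockRotations.

(** * Factorization of a block rotation into exponentials *)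

Lemma annihilated_spectrum_size (F : fieldType) (n : nat) (A : 'M[F]_n.+1)
    (s : seq F) (q : {poly F}) :
  mxminpoly A = \prod_(x <- s) ('X - x%:P) ->
  q != 0 -> horner_mx A q = 0 -> (size s < size q)%N.
Proof.
move=> mA q0 /mxminpoly_min /(dvdp_leq q0).
by rewrite mA size_prod_XsubC.
Qed.

Lemma mulmx_skew_lift0 (R : comPzRingType) (m n : nat) (H T : 'M[R]_(m, n))
    (A B C : 'M[R]_n) (k : R) :
  H^T *m H = k%:M -> T^T *m T = k%:M -> T^T *m H = A -> H^T *m T = A ->
  B *m A *m C = 0 -> B *m C = 0 -> skew_lift H T B *m skew_lift H T C = 0.
Proof.
move=> HH TT TH HT BAC BC; rewrite (skew_lift_mul _ _ HH TT TH HT) BAC BC.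
by rewrite !mulmx0 !mul0mx !addr0 scaler0 subr0.
Qed.

Section RotationFactorization.

Variables (R : realType) (m n d : nat) (H T : 'M[R]_(m, n.+1)) (A : 'M[R]_n.+1).
Variables (k : R) (B : nat -> 'M[R]_n.+1) (c : nat -> nat -> R).
Hypotheses (k0 : 0 < k) (HH : H^T *m H = k%:M) (TT : T^T *m T = k%:M)
  (TH : T^T *m H = A) (HT : H^T *m T = A) (Asym : A^T = A) (Ak : eigenvalue A k).
Hypotheses (B0 : B 0%N = 1)
  (AB : forall i, (i < d)%N -> A *m B i = \sum_(l < i.+2) c i l *: B l)
  (c0 : forall i, (i < d)%N -> c i i.+1 != 0)
  (ABd : A *m B d = \sum_(l < d.+1) c d l *: B l).

Lemma distance_polys : exists v : nat -> {poly R}, forall i, (i <= d)%N ->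
  size (v i) = i.+1 /\ horner_mx A (v i) = B i.
Proof. exact: three_term_polys B0 AB c0. Qed.

Lemma skew_lift_distance_commute (i j : nat) : (i <= d)%N -> (j <= d)%N ->
  skew_lift H T (B i) *m skew_lift H T (B j) =
  skew_lift H T (B j) *m skew_lift H T (B i).
Proof.
have [v vP] := distance_polys; move=> /vP[_ <-] /vP[_ <-].
rewrite !(skew_lift_mul _ _ HH TT TH HT).
have comm p q : horner_mx A p *m horner_mx A q = horner_mx A q *m horner_mx A p.
  exact: comm_horner_mx2.
have commA p : horner_mx A p *m A = A *m horner_mx A p.
  by have := comm p 'X; rewrite horner_mx_X.
by rewrite !commA -!(mulmxA A) (comm (v i) (v j)).
Qed.

(** The recurrence closes up at [d]: by [ABd], the polynomial ['X * v d - r] of degree [d.+1]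
    annihilates [A], which bounds the number of eigenvalues. *)
Lemma distance_spectrum : exists s : seq R,
  [/\ uniq s, mxminpoly A = \prod_(x <- s) ('X - x%:P), k \in s & (size s <= d.+1)%N].
Proof.
have [s us mA] := symmetric_mxminpoly Asym; exists s; split => //.
  by move: Ak; rewrite eigenvalue_root_min mA root_prod_XsubC.
have [v vP] := distance_polys; have [svd hvd] := vP d (leqnn d).
pose r := \sum_(l < d.+1) c d l *: v l.
have sX : size ('X * v d) = d.+2.
  by rewrite mulrC size_mulX ?svd // -size_poly_eq0 svd.
have sq : size ('X * v d - r) = d.+2.
  rewrite size_polyDl sX // size_polyN ltnS (leq_trans (size_sum _ _ _)) //.
  apply/bigmax_leqP => l _; rewrite (leq_trans (size_scale_leq _ _)) //.
  by rewrite (proj1 (vP l _)) // -ltnS.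
rewrite -ltnS -sq; apply: annihilated_spectrum_size mA _ _.
  by rewrite -size_poly_eq0 sq.
rewrite rmorphB rmorphM /= horner_mx_X hvd [A * _]ABd raddf_sum /=.
apply/eqP; rewrite subr_eq0; apply/eqP; apply: eq_bigr => l _.
by rewrite (horner_mxZ A) (proj2 (vP l _)) // -ltnS.
Qed.

Theorem grover_sqr_factorization : exists t : nat -> R,
  1%:M + (4%:R / k ^+ 2) *: (H *m A *m T^T)
    - (2%:R / k) *: (H *m H^T + T *m T^T) =
  \prod_(0 <= i < d) mexp (t i.+1 *: skew_lift H T (B i)) :> 'M[R]_m.
Proof.
have [v vP] := distance_polys.
have [s [us mA ks ss]] := distance_spectrum.
have [L [hE hL LL]] := spectral_projectors us mA.
pose E x := horner_mx A (L x).
pose sg := block_speed k; pose phi x := acos (x / k) *+ 2.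
pose J x := (sg x)^-1 *: skew_lift H T (E x).
have AE x : x \in s -> A *m E x = x *: E x.
  by move=> xs; rewrite -{1}(horner_mx_X A) [LHS]hL // hornerX.
have EE' x y : x \in s -> y \in s -> x != y -> E x *m E y = 0.
  by move=> xs ys xy; exact: LL.
have sum1 : 1%:M = \sum_(x <- s) E x.
  rewrite -[LHS](rmorph1 (horner_mx A)) /= hE; apply: eq_bigr => x _.
  by rewrite hornerC scale1r.
have EE x : x \in s -> E x *m E x = E x.
  move=> xs; rewrite -[RHS]mul1mx sum1 mulmx_suml (bigD1_seq x) //=.
  by rewrite big_seq_cond big1 ?addr0 // => y /andP[ys yx]; rewrite EE'.
have Esym x : (E x)^T = E x.
  rewrite /E; move: (L x) => p; elim/poly_ind: p => [|p a IHp].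
    by rewrite rmorph0 trmx0.
  rewrite rmorphD rmorphM /= horner_mx_X horner_mx_C linearD /= tr_scalar_mx.
  rewrite [(_ * A)^T]trmx_mul IHp Asym; congr (_ + _).
  by have := comm_horner_mx2 A 'X p; rewrite horner_mx_X.
have KJ x : x \in s -> skew_lift H T (E x) = sg x *: J x.
  by move=> xs; apply: (skew_liftE k0 HH TT TH HT) => //; [exact: AE | exact: EE].
have Jorth : orthogonal_units s J.
  split => [x y xs ys xy|x xs]; last first.
    by apply: (unit_skew_cube k0 HH TT TH HT) => //; [exact: AE | exact: EE].
  rewrite /J -scalemxAl -scalemxAr (mulmx_skew_lift0 HH TT TH HT) ?scaler0 //.
    by rewrite -mulmxA AE // -scalemxAr EE' // scaler0.
  exact: EE'.
have sgk : sg k = 0.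
  by rewrite /sg /block_speed divff ?gt_eqF // expr1n subrr sqrtr0 mulr0.
(* Removing [k] leaves at most [d] nodes, so [p] lies in the span of the [v i] with [i < d]. At a
   remaining node of speed 0 the quotient is the default 0, which is harmless because [J x = 0]
   there. *)
have [p sp pE] := poly_interpolation (fun x => phi x / sg x) (rem_uniq k us).
have [||t tE] := @graded_polys_span _ v d _ p.
- by move=> i /ltnW/vP[].
- rewrite (leq_trans sp) // size_rem // -ltnS (leq_trans _ ss) // prednK //.
  by case: (s) ks.
(* Partial products remain rotations whose angles add up. *)
have prodE j : (j <= d)%N ->
    \prod_(0 <= i < j) mexp (t i *: skew_lift H T (B i)) =
    rotation s J (fun x => \sum_(i < j) t i * (v i).[x] * sg x).
  elim: j => [_|j IHj jd].
    rewrite big_geq // -[LHS](rotation0 s J); congr rotation.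
    by apply/funext => x; rewrite big_ord0.
  rewrite big_nat_recr //= IHj 1?ltnW //.
  have -> : t j *: skew_lift H T (B j) = \sum_(x <- s) (t j * (v j).[x] * sg x) *: J x.
    rewrite -(proj2 (vP j (ltnW jd))) hE skew_lift_sum scaler_sumr.
    by apply: eq_big_seq => x xs; rewrite KJ // !scalerA.
  rewrite mexp_rotation // [LHS]rotationD //; congr rotation.
  by apply/funext => x; rewrite big_ord_recr.
(* The scalars of the theorem are numbered from 1, the polynomials [v i] from 0. *)
exists (fun i => t i.-1); rewrite [RHS]prodE // {prodE}.
rewrite -addrA; congr (_ + _); rewrite /rotation.
have AE' : A = \sum_(x <- s) x *: E x.
  by rewrite -[LHS](horner_mx_X A) hE; apply: eq_bigr => x _; rewrite hornerX.
transitivity (\sum_(x <- s) ((4%:R / k ^+ 2 * x) *: (H *m E x *m T^T)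
   - (2%:R / k) *: (H *m E x *m H^T + T *m E x *m T^T))).
  rewrite sumrB -scaler_sumr big_split /= -!mulmx_suml -!mulmx_sumr -sum1.
  rewrite !mulmx1 {1}AE' mulmx_sumr mulmx_suml scaler_sumr; congr (_ - _).
  by apply: eq_bigr => x _; rewrite -scalemxAr -scalemxAl scalerA.
apply: eq_big_seq => x xs.
rewrite -mulr_suml; have -> : \sum_(i < d) t i * (v i).[x] = p.[x].
  by rewrite tE horner_sum; apply: eq_bigr => i _; rewrite hornerZ.
rewrite (grover_block_rotation k0 HH TT TH HT) //; [|exact: AE|exact: EE].
have [sg0|sg0] := eqVneq (sg x) 0.
  by rewrite -/sg sg0 invr0 scale0r mul0mx !scaler0 /J sg0 invr0 scale0r mul0mx !scaler0.
suff -> : p.[x] * sg x = phi x by [].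
(* Since the speed vanishes at [k], a nonzero speed makes [x] one of the interpolation nodes. *)
rewrite pE ?divfK // (rem_filter k us) mem_filter xs andbT /=.
by apply: contraNneq sg0 => ->; rewrite sgk.
Qed.

End RotationFactorization.

(** * Distances in the graph and in its line digraph *)

Section Distance.

Variables (V : finType) (e : rel V).
Hypotheses (e_sym : forall u v, e u v = e v u) (e_irr : forall u, ~~ e u u).

Lemma reach_leq (m n : nat) (u v : V) : (m <= n)%N -> reach e m u v -> reach e n u v.
Proof.
elim: n => [|n IHn]; first by rewrite leqn0 => /eqP->.
by rewrite leq_eqVlt => /predU1P[->//|/IHn IH /IH /= ->].
Qed.

(** [reach] extends walks at their end; extending at the start is what reversing a walk requires. *)
Lemma reach_cons (n : nat) (u w v : V) : e u w -> reach e n w v -> reach e n.+1 u v.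
Proof.
elim: n v => [|n IHn] v uw.
  by move=> /= /eqP <-; apply/orP; right; apply/existsP; exists u; rewrite eqxx.
move=> /= /orP[/(IHn _ uw)|/existsP[x /andP[wx xv]]]; first by move=> /= ->.
apply/orP; right; apply/existsP; exists x; rewrite xv andbT.
exact: IHn uw wx.
Qed.

Lemma reach_sym (n : nat) (u v : V) : reach e n u v = reach e n v u.
Proof.
suff imp u' v' : reach e n u' v' -> reach e n v' u' by apply/idP/idP; exact: imp.
elim: n v' => [|n IHn] v' /=; first by rewrite eq_sym.
case/orP=> [/IHn -> //|/existsP[w /andP[/IHn wu wv]]].
by rewrite e_sym in wv; exact: reach_cons wv wu.
Qed.

Lemma is_dist_sym (u v : V) (i : nat) : is_dist e u v i = is_dist e v u i.
Proof. by rewrite /is_dist reach_sym (reach_sym i.-1). Qed.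

Lemma is_dist_inj (u v : V) (i j : nat) : is_dist e u v i -> is_dist e u v j -> i = j.
Proof.
suff le i' j' : is_dist e u v i' -> is_dist e u v j' -> (i' <= j')%N.
  by move=> ui uj; apply/eqP; rewrite eqn_leq !le.
case/andP=> _ /predU1P[-> //|far] /andP[near _]; rewrite leqNgt.
apply: contra far => ji; apply: reach_leq near.
by rewrite -ltnS (ltn_predK ji).
Qed.

Lemma is_dist0 (u v : V) : is_dist e u v 0 = (u == v).
Proof. by rewrite /is_dist /= andbT. Qed.

Lemma is_dist1 (u v : V) : is_dist e u v 1 = e u v.
Proof.
rewrite /is_dist /=; have [<-|uv] /= := eqVneq u v; first by rewrite (negPf (e_irr u)).
rewrite andbT; apply/existsP/idP => [[w /andP[/eqP <-]] //|uv'].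
by exists u; rewrite eqxx.
Qed.

Lemma is_dist_step (u w v : V) (i l : nat) :
  e u w -> is_dist e w v i -> is_dist e u v l -> (l <= i.+1)%N.
Proof.
move=> uw /andP[wv _] /andP[_ /predU1P[-> //|]]; apply: contraR.
rewrite -ltnNge => il; apply: reach_leq (reach_cons uw wv).
by rewrite -ltnS (ltn_predK il).
Qed.

Lemma is_dist_pred (u v : V) (l : nat) :
  is_dist e u v l.+1 -> exists2 w, e u w & is_dist e w v l.
Proof.
rewrite is_dist_sym => /andP[/= /orP[->//|/existsP[w /andP[vw wu]] far]].
exists w; first by rewrite e_sym.
rewrite is_dist_sym /is_dist vw; case: l far {vw} => //= l; apply: contra => vw.
by apply/orP; right; apply/existsP; exists w; rewrite vw.
Qed.

(** A nonempty walk from [x] to [y] in the line digraph traces a walk from the head of [x] to the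
    tail of [y], one step shorter. The case [x == y] is the empty walk, since [reach] bounds the
    length only from above. *)
Lemma reach_ld (n : nat) (x y : Defs.arc e) :
  reach (@ld_rel V e) n.+1 x y = (x == y) || reach e n (val x).2 (val y).1.
Proof.
elim: n y => [|n IHn] y.
  rewrite /=; congr (_ || _); apply/existsP/eqP => [[w /andP[/eqP <- /eqP]] //|xy].
  by exists x; rewrite eqxx /ld_rel xy eqxx.
have -> : reach (@ld_rel V e) n.+2 x y = reach (@ld_rel V e) n.+1 x y ||
    [exists w, reach (@ld_rel V e) n.+1 x w && ld_rel w y] by [].
rewrite IHn -orbA; congr (_ || _).
rewrite [reach e n.+1 _ _]/=.
apply/orP/orP => -[->|/existsP[w]]; [by left| |by left|].
  rewrite IHn => /andP[/orP[/eqP <-|xw] /eqP wy].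
    by left; rewrite -wy; apply: (@reach_leq 0) => //=.
  right; apply/existsP; exists (val w).1; rewrite xw -wy; exact: valP w.
case/andP=> xw wy; right; apply/existsP; exists (exist _ (w, (val y).1) wy).
by rewrite IHn /= xw orbT /ld_rel /= eqxx.
Qed.

(** An arc is at distance 0 from itself, whence the condition [x != y]: the head and tail of a
    single arc are also at some distance, namely 1. *)
Lemma dist_digraphS (i : nat) (x y : Defs.arc e) :
  dist_digraph i.+1 x y = (x != y) && is_dist e (val x).2 (val y).1 i.
Proof.
rewrite /dist_digraph /is_dist reach_ld; case: i => [|i].
  by rewrite /=; have [->|] //= := eqVneq x y.
by rewrite [_.+1.-1]/= reach_ld negb_or; have [->|] //= := eqVneq x y.
Qed.

End Distance.

(** * Incidence matrices and intersection numbers *)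

Section Incidence.

Variables (R : comNzRingType) (V : finType) (e : rel V) (n : nat) (vtx : 'I_n -> V).
Hypothesis vtx_bij : bijective vtx.

(** Indexing through a bijection [vtx] lets [n] be syntactically a successor, as the results above
    on polynomials in a matrix demand. *)
Definition vertex_mx (F : V -> V -> R) : 'M[R]_n := \matrix_(a, b) F (vtx a) (vtx b).

Definition incidence_mx (h : Defs.arc e -> V) : 'M[R]_(narc e, n) :=
  \matrix_(i, a) (h (enum_val i) == vtx a)%:R.

Lemma sum_vertex_eq (u : V) (F : V -> R) :
  \sum_(a < n) (u == vtx a)%:R * F (vtx a) = F u.
Proof.
rewrite -(reindex vtx (F := fun v => (u == v)%:R * F v) (P := xpredT));
  last exact: onW_bij.
rewrite (bigD1 u) //= eqxx mul1r big1 ?addr0 // => v vu.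
by rewrite eq_sym (negPf vu) mul0r.
Qed.

Lemma vertex_mx1 : vertex_mx (fun u v => (u == v)%:R) = 1%:M.
Proof. by apply/matrixP => a b; rewrite !mxE (bij_eq vtx_bij). Qed.

Lemma mul_vertex_mx (F G : V -> V -> R) :
  vertex_mx F *m vertex_mx G = vertex_mx (fun u v => \sum_w F u w * G w v).
Proof.
apply/matrixP => a b; rewrite !mxE.
rewrite (reindex vtx); last exact: onW_bij.
by apply: eq_bigr => c _; rewrite !mxE.
Qed.

Lemma incidence_sandwich (h g : Defs.arc e -> V) (F : V -> V -> R) :
  incidence_mx h *m vertex_mx F *m (incidence_mx g)^T = arc_mx (fun x y => F (h x) (g y)).
Proof.
apply/matrixP => i j; rewrite !mxE.
under eq_bigr => b _.
  rewrite !mxE mulrC; under eq_bigr => a _ do rewrite !mxE.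
  rewrite (sum_vertex_eq _ (fun u => F u (vtx b))).
  over.
exact: sum_vertex_eq.
Qed.

Lemma tr_incidence_mul (g h : Defs.arc e -> V) :
  (incidence_mx g)^T *m incidence_mx h =
  vertex_mx (fun u v => #|[set x | (g x == u) && (h x == v)]|%:R).
Proof.
apply/matrixP => a b; rewrite !mxE.
rewrite -sum1dep_card natr_sum [RHS]big_mkcond /=.
rewrite [RHS](reindex (fun i : 'I_(narc e) => enum_val i : Defs.arc e)) /=; last first.
  by apply: onW_bij; exact: enum_val_bij.
apply: eq_bigr => i _; rewrite !mxE -natrM mulnb.
by case: ifP.
Qed.

End Incidence.

Section Graph.

Variables (V : finType) (e : rel V).
Hypotheses (e_sym : forall u v, e u v = e v u) (e_irr : forall u, ~~ e u u).

Definition arc_head (x : Defs.arc e) : V := (val x).2.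
Definition arc_tail (x : Defs.arc e) : V := (val x).1.

Lemma card_tail_head (u v : V) :
  #|[set x | (arc_tail x == u) && (arc_head x == v)]| = e u v.
Proof.
have [uv|uv] := boolP (e u v).
  rewrite [RHS](_ : _ = 1%N) // -(cards1 (exist (fun p => e p.1 p.2) (u, v) uv)).
  by apply: eq_card => x; rewrite !inE -val_eqE /= -pair_eqE.
apply: eq_card0 => x; rewrite !inE; apply: contraNF uv.
by case/andP=> /eqP <- /eqP <-; exact: valP x.
Qed.

(** Treats heads and tails at once: the arcs with end [h x = v] are sorted by their other end [g x],
    giving one arc per neighbour of [v]. *)
Lemma card_arc_end (g h : Defs.arc e -> V) (k : nat) (u v : V) :
  (forall w, #|[set x | (g x == w) && (h x == v)]| = e v w) ->
  regular_graph e k ->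
  #|[set x | (h x == u) && (h x == v)]| = (if u == v then k else 0)%N.
Proof.
move=> gh reg; have [->|uv] := eqVneq u v; last first.
  apply: eq_card0 => x; rewrite !inE.
  by apply/negP => /andP[/eqP -> /eqP vu]; rewrite vu eqxx in uv.
rewrite -(reg v) -!sum1dep_card (partition_big g xpredT) //=.
rewrite [RHS]big_mkcond; apply: eq_bigr => w _; under eq_bigl do rewrite andbb andbC.
by rewrite sum1dep_card gh; case: (e v w).
Qed.

Lemma card_head_head (k : nat) (u v : V) : regular_graph e k ->
  #|[set x | (arc_head x == u) && (arc_head x == v)]| = (if u == v then k else 0)%N.
Proof.
by apply: (@card_arc_end arc_tail) => w; rewrite card_tail_head e_sym.
Qed.

Lemma card_tail_tail (k : nat) (u v : V) : regular_graph e k ->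
  #|[set x | (arc_tail x == u) && (arc_tail x == v)]| = (if u == v then k else 0)%N.
Proof.
apply: (@card_arc_end arc_head) => w; rewrite -card_tail_head.
by apply: eq_card => x; rewrite !inE andbC.
Qed.

(* [p^l_(1,i)], or [0] when no two vertices are at distance [l]. *)
Definition intersection_number (i l : nat) : nat :=
  if [pick p : V * V | is_dist e p.1 p.2 l] is Some p
  then #|[set w | is_dist e p.1 w 1 && is_dist e w p.2 i]| else 0%N.

Hypothesis e_dr : distance_regular e.

Lemma intersection_numberE (u v : V) (i l : nat) : is_dist e u v l ->
  intersection_number i l = #|[set w | e u w && is_dist e w v i]|.
Proof.
move=> uvl; rewrite /intersection_number.
case: pickP => [p pl|/(_ (u, v))]; last by rewrite uvl.
rewrite (e_dr 1 i pl uvl); apply: eq_card => w.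
by rewrite !inE is_dist1.
Qed.

Lemma intersection_number_gt (i l : nat) : (i.+1 < l)%N -> intersection_number i l = 0%N.
Proof.
move=> il; rewrite /intersection_number; case: pickP => // p pl.
apply: eq_card0 => w; rewrite !inE is_dist1 //; apply/negP => /andP[pw wp].
by have := is_dist_step pw wp pl; rewrite leqNgt il.
Qed.

Hypothesis e_conn : connected_graph e.
Variable d : nat.
Hypothesis e_diam : has_diameter e d.

(** Starting from a diametral pair, the first step of a geodesic is removed repeatedly. *)
Lemma is_dist_realized (l : nat) : (l <= d)%N -> exists u v, is_dist e u v l.
Proof.
move=> ld; rewrite -(subKn ld); elim: (d - l)%N => [|j [u [v uv]]].
  by rewrite subn0; case: e_diam.
(* Once [d <= j], truncated subtraction stays at 0 and the same pair serves. *)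
have [dj|jd] := leqP d j.
  exists u, v; move: uv; have /eqP -> : (d - j == 0)%N by rewrite subn_eq0.
  by have /eqP -> : (d - j.+1 == 0)%N by rewrite subn_eq0 ltnW.
rewrite -(ltn_predK (n := d - j) (m := 0)) ?subn_gt0 // -subnS in uv.
by have [w _ wv] := is_dist_pred e_sym uv; exists w, v.
Qed.

Lemma intersection_numberS (i : nat) : (i < d)%N -> intersection_number i i.+1 != 0%N.
Proof.
case/is_dist_realized=> u [v uv]; rewrite (intersection_numberE _ uv) -lt0n card_gt0.
have [w uw wv] := is_dist_pred e_sym uv.
by apply/set0Pn; exists w; rewrite inE uw.
Qed.

(** Only the term at [l = dist(u,v)] survives on the right. If the cut-off [b] misses it, the left
    side is 0 by the triangle inequality when [i.+2 <= b], while [d < b] makes this impossible. The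
    cut-offs [i.+2] and [d.+1] give the recurrence and its closing relation. *)
Lemma sum_adj_dist (R : nzRingType) (u v : V) (i b : nat) :
  (i.+2 <= b)%N || (d < b)%N ->
  \sum_w (e u w)%:R * (is_dist e w v i)%:R =
  \sum_(l < b) (intersection_number i l)%:R * (is_dist e u v l)%:R :> R.
Proof.
move=> bP; have [l uvl] := e_conn u v.
transitivity ((intersection_number i l)%:R : R).
  rewrite (intersection_numberE i uvl) -sum1dep_card natr_sum [RHS]big_mkcond.
  by apply: eq_bigr => w _; rewrite -natrM mulnb; case: ifP.
have [lb|bl] := ltnP l b.
  rewrite (bigD1 (Ordinal lb)) //= uvl mulr1 big1 ?addr0 // => j jl.
  case: (boolP (is_dist e u v j)) => [uvj|]; last by rewrite mulr0.
  by case/eqP: jl; apply: val_inj; exact: is_dist_inj uvj uvl.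
have ld : (l <= d)%N by case: e_diam => _; apply; exact: uvl.
have il : (i.+1 < l)%N.
  case/orP: bP => [/leq_trans->//|db].
  by have := leq_trans db bl; rewrite ltnNge ld.
rewrite (intersection_number_gt il) big1 // => j _.
case: (boolP (is_dist e u v j)) => [uvj|]; last by rewrite mulr0.
have jl := is_dist_inj uvj uvl.
by have := ltn_ord j; rewrite jl ltnNge bl.
Qed.

End Graph.

(** * The square of the Grover walk *)

Section Grover.

Variables (R : fieldType) (V : finType) (e : rel V).
Hypothesis e_sym : forall u v, e u v = e v u.

Fact rev_arc_subproof (x : Defs.arc e) : e (arc_head x) (arc_tail x).
Proof. by rewrite e_sym; exact: valP x. Qed.

Definition rev_arc (x : Defs.arc e) : Defs.arc e :=
  exist (fun p => e p.1 p.2) (arc_head x, arc_tail x) (rev_arc_subproof x).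

Lemma rev_arcK : involutive rev_arc.
Proof. by move=> x; apply: val_inj; case: x => -[]. Qed.

Definition rev_index (i : 'I_(narc e)) : 'I_(narc e) :=
  enum_rank (rev_arc (enum_val i)).

Lemma rev_indexK : involutive rev_index.
Proof. by move=> i; rewrite /rev_index enum_rankK rev_arcK enum_valK. Qed.

Lemma rev_mxE : rev_mx R e = rowsub rev_index 1%:M.
Proof.
apply/matrixP => i j; rewrite !mxE; congr (_%:R).
by rewrite -[j in RHS]enum_valK (inj_eq enum_rank_inj) eq_sym -val_eqE.
Qed.

Lemma mul_rev_mx (p : nat) (M : 'M[R]_(narc e, p)) : rev_mx R e *m M = rowsub rev_index M.
Proof. by rewrite rev_mxE -rowsubE. Qed.

Lemma rev_mx_sqr : rev_mx R e *m rev_mx R e = 1%:M.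
Proof.
by rewrite mul_rev_mx rev_mxE; apply/matrixP => i j; rewrite !mxE rev_indexK.
Qed.

Lemma tr_rev_mx : (rev_mx R e)^T = rev_mx R e.
Proof.
apply/matrixP => i j; rewrite rev_mxE !mxE; congr (_%:R).
by rewrite -(inj_eq (inv_inj rev_indexK)) rev_indexK eq_sym.
Qed.

Variables (n : nat) (vtx : 'I_n -> V).
Hypothesis vtx_bij : bijective vtx.
Let H := incidence_mx R vtx (@arc_head V e).
Let T := incidence_mx R vtx (@arc_tail V e).

Lemma rev_mul_head : rev_mx R e *m H = T.
Proof.
by rewrite mul_rev_mx; apply/matrixP => i a; rewrite !mxE /rev_index enum_rankK.
Qed.

Lemma rev_mul_tail : rev_mx R e *m T = H.
Proof.
by rewrite mul_rev_mx; apply/matrixP => i a; rewrite !mxE /rev_index enum_rankK.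
Qed.

Lemma A_LDE : A_LD R e = H *m T^T.
Proof.
by rewrite -[H]mulmx1 -(vertex_mx1 _ vtx_bij) incidence_sandwich.
Qed.

(** Expand the square of [(2 / k) H T^T - R]: the involution [R] is symmetric and exchanges [H] and
    [T], so the cross terms become [H *m H^T] and [T *m T^T]. *)
Lemma grover_sqr (k : nat) : k%:R != 0 :> R ->
  grover R e k ^+ 2 =
  1%:M + (4%:R / k%:R ^+ 2) *: (H *m (T^T *m H) *m T^T)
    - (2%:R / k%:R) *: (H *m H^T + T *m T^T).
Proof.
move=> k0; rewrite expr2 -[LHS]/(grover R e k *m grover R e k) /grover A_LDE.
rewrite mulmxBl !mulmxBr rev_mx_sqr -!scalemxAr -!scalemxAl.
have -> : H *m T^T *m rev_mx R e = H *m H^T.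
  by rewrite -mulmxA -[rev_mx R e in LHS]tr_rev_mx -trmx_mul rev_mul_tail.
rewrite (mulmxA (rev_mx R e)) rev_mul_head !mulmxA.
move: (_ *m H *m T^T) (H *m H^T) (T *m T^T) => P Q S.
by apply/matrixP => i j; rewrite !mxE; field.
Qed.

End Grover.

Lemma skew_adj_dist_digraphS (R : comNzRingType) (V : finType) (e : rel V) (n : nat)
    (vtx : 'I_n -> V) (i : nat) :
  (forall u v, e u v = e v u) -> bijective vtx ->
  skew_adj R (@dist_digraph V e i.+1) =
  skew_lift (incidence_mx R vtx (@arc_head V e)) (incidence_mx R vtx (@arc_tail V e))
    (vertex_mx vtx (fun u v => (is_dist e u v i)%:R)).
Proof.
move=> e_sym vtx_bij; rewrite /skew_lift !incidence_sandwich //.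
apply/matrixP => a b; rewrite !mxE !dist_digraphS //.
rewrite (eq_sym (enum_val b)) (is_dist_sym e_sym (arc_tail _)).
by have [->|] := eqVneq (enum_val a) (enum_val b); rewrite //= !subrr.
Qed.

Theorem theorem6p1 (R : realType) (V : finType) (e : rel V) (k d : nat) :
  simple_graph e -> connected_graph e -> regular_graph e k ->
  distance_regular e -> has_diameter e d ->
  adj_mx R e \in unitmx ->
  (exists t : nat -> R,
     grover R e k ^+ 2 =
     \prod_(0 <= i < d) mexp (t i.+1 *: skew_adj R (@dist_digraph V e i.+1))) /\
  (forall i j, (1 <= i <= d)%N -> (1 <= j <= d)%N ->
     skew_adj R (@dist_digraph V e i) *m skew_adj R (@dist_digraph V e j) =
     skew_adj R (@dist_digraph V e j) *m skew_adj R (@dist_digraph V e i)).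
Proof.
move=> [e_sym e_irr] conn reg dr diam A_unit.
have [u0 _] : exists u0 : V, True by case: diam => -[u0 _] _; exists u0.
have [n cardV] : exists n, n.+1 = #|V|.
  by exists #|V|.-1; rewrite prednK //; apply/card_gt0P; exists u0.
pose vtx (a : 'I_n.+1) : V := enum_val (cast_ord cardV a).
have vtx_bij : bijective vtx.
  apply: bij_comp; first exact: enum_val_bij.
  by exists (cast_ord (esym cardV)); [exact: cast_ordK | exact: cast_ordKV].
(* For [k = 0] the adjacency matrix would be the zero matrix of positive size, which is not
   invertible. *)
have k_gt0 : 0 < k%:R :> R.
  rewrite ltr0n lt0n; apply: contraTneq A_unit => k0.
  have -> : adj_mx R e = 0.
    apply/matrixP => a b; rewrite !mxE; case: (boolP (e _ _)) => // ab.
    have := reg (enum_val a); rewrite k0 => /eqP; rewrite cards_eq0 => /eqP/setP.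
    by move/(_ (enum_val b)); rewrite !inE ab.
  by rewrite -cardV unitr0.
pose A : 'M[R]_n.+1 := vertex_mx vtx (fun u v => (e u v)%:R).
pose B i : 'M[R]_n.+1 := vertex_mx vtx (fun u v => (is_dist e u v i)%:R).
pose H := incidence_mx R vtx (@arc_head V e).
pose T := incidence_mx R vtx (@arc_tail V e).
have HH : H^T *m H = k%:R%:M.
  rewrite tr_incidence_mul; apply/matrixP => a b; rewrite !mxE.
  rewrite (card_head_head e_sym _ _ reg) (bij_eq vtx_bij).
  by case: (a == b).
have TT : T^T *m T = k%:R%:M.
  rewrite tr_incidence_mul; apply/matrixP => a b; rewrite !mxE.
  rewrite (card_tail_tail _ _ reg) (bij_eq vtx_bij).
  by case: (a == b).
have TH : T^T *m H = A.
  by rewrite tr_incidence_mul; apply/matrixP => a b; rewrite !mxE card_tail_head.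
have Asym : A^T = A by apply/matrixP => a b; rewrite !mxE e_sym.
have HT : H^T *m T = A by rewrite -[H^T *m T]trmxK trmx_mul trmxK TH.
(* By regularity, the all-ones vector is an eigenvector. *)
have Ak : eigenvalue A k%:R.
  apply/eigenvalueP; exists (const_mx 1); last first.
    by apply/eqP => /matrixP /(_ 0 0) /eqP; rewrite !mxE oner_eq0.
  apply/rowP => b; rewrite !mxE mulr1 -(reg (vtx b)) -sum1dep_card natr_sum.
  rewrite [RHS]big_mkcond (reindex vtx) /=; last exact: onW_bij.
  by apply: eq_bigr => a _; rewrite !mxE mul1r e_sym; case: (e _ _).
pose c i l : R := (intersection_number e i l)%:R.
have AB i b : (i.+2 <= b)%N || (d < b)%N -> A *m B i = \sum_(l < b) c i l *: B l.
  move=> bP; rewrite mul_vertex_mx //; apply/matrixP => x y; rewrite summxE mxE.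
  rewrite (sum_adj_dist e_irr dr conn diam R _ _ bP).
  by apply: eq_bigr => l _; rewrite !mxE.
have B0 : B 0%N = 1.
  by apply/matrixP => x y; rewrite !mxE is_dist0 (bij_eq vtx_bij).
have ABi i : (i < d)%N -> A *m B i = \sum_(l < i.+2) c i l *: B l.
  by move=> _; apply: AB; rewrite leqnn.
have c0 i : (i < d)%N -> c i i.+1 != 0.
  by move=> id; rewrite pnatr_eq0 (intersection_numberS e_sym e_irr dr diam).
have ABd : A *m B d = \sum_(l < d.+1) c d l *: B l by apply: AB; rewrite ltnSn orbT.
split=> [|[//|i] [//|j] /= id jd].
  have [t tE] := grover_sqr_factorization k_gt0 HH TT TH HT Asym Ak B0 ABi c0 ABd.
  exists t; rewrite (grover_sqr e_sym vtx_bij) ?gt_eqF // TH tE.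
  by apply: eq_bigr => i _; rewrite (skew_adj_dist_digraphS R _ e_sym vtx_bij).
rewrite !(skew_adj_dist_digraphS R _ e_sym vtx_bij).
by apply: (skew_lift_distance_commute HH TT TH HT B0 ABi c0); exact: ltnW.
Qed.
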